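(* Assume that: (a) $\operatorname{supp}(\mu_X)\subset\operatorname{supp}(\mu_{X'})$; (b) there exists an integer $m_0\ge 1$ such that $\mathbb{E}\left[\min_{1\le j\le m_0}|X'_j|\right]<+\infty$. Then for all $q\in[1,+\infty)$ such that $\mathbb{E}[|X|^q]<+\infty$, where $X\sim\mu_X$, and any sequence of positive integers $(k_m)_{m\ge1}$ with $k_m\le m$ such that $k_m/m\to0$ when $m\to+\infty$, we have $$\lim_{m\to+\infty}\mathbb{E}\left[W_q^q\left(\hat{\mu}_{\mathbf{X}_n},\hat{\mu}_{\mathbf{X}'_m}^{(k_m)}\right)\right]=0,$$ uniformly in $n\ge1$.
   Context: $|\cdot|$ is a fixed norm on $\mathbb{R}^d$ (not necessarily Euclidean). $\mu_X,\mu_{X'}$ are probability measures on $\mathbb{R}^d$. $(X_i)_{i\ge1}$ are i.i.d. with law $\mu_X$, $(X'_j)_{j\ge1}$ are i.i.d. with law $\mu_{X'}$, and the two samples are independent; $\mathbf{X}_n=(X_1,\dots,X_n)$, $\mathbf{X}'_m=(X'_1,\dots,X'_m)$. With $B(x,r)=\{x':|x-x'|\le r\}$, $\operatorname{supp}(\nu)=\{x\in\mathbb{R}^d:\forall r>0,\ \nu(B(x,r))>0\}$. For $q\in[1,+\infty)$, $W_q(\mu,\nu)=\inf\{\int|x-x'|^q\,d\gamma(x,x'):\gamma\in\Pi(\mu,\nu)\}^{1/q}$, where $\Pi(\mu,\nu)$ is the set of couplings of $\mu$ and $\nu$. For $x\in\mathbb{R}^d$, order the indices $1,\dots,m$ by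 increasing distance $|x-X'_j|$, ties broken by lowest index, and let $j^{(l)}(x)$ be the $l$-th index in this order. Set $\hat{\mu}_{\mathbf{X}_n}:=\frac1n\sum_{i=1}^n\delta_{X_i}$ and, for $k\in\{1,\dots,m\}$, $$\hat{\mu}_{\mathbf{X}'_m}^{(k)}:=\frac1m\sum_{j=1}^m w^{(k)}_j\delta_{X'_j},\qquad w^{(k)}_j:=\frac{m}{kn}\sum_{i=1}^n\sum_{l=1}^k\mathbf{1}_{\{j=j^{(l)}(X_i)\}}$$ (this measure also depends on $\mathbf{X}_n$). *)

(* Defs.v *)
From mathcomp Require Import all_boot all_order all_algebra.
From mathcomp Require Import all_classical all_reals all_analysis.

Set Implicit Arguments.
Unset Strict Implicit.
Unset Printing Implicit Defensive.

Import Order.TTheory GRing.Theory Num.Theory.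
Import numFieldNormedType.Exports.

Local Open Scope classical_set_scope.
Local Open Scope ring_scope.

(* The Borel sigma-algebra does not depend on the norm, so it is taken from
   the library's topology on row vectors (that of the sup norm). *)
Notation Rd R d := (g_sigma_algebraType (@open 'rV[R]_d)).

Record is_norm (R : realType) (V : lmodType R) (N : V -> R) : Prop := IsNorm {
  norm_triangle : forall x y, N (x + y) <= N x + N y ;
  norm_scale : forall (a : R) x, N (a *: x) = `|a| * N x ;
  norm_definite : forall x, N x = 0 -> x = 0
}.

Section independence.
Context dO dT (Omega : measurableType dO) (T : measurableType dT)
  (R : realType) (P : probability Omega R).

Definition mutually_independent (X : nat -> Omega -> T) :=
  forall (s : seq nat) (A : nat -> set T), uniq s ->
    (forall i, measurable (A i)) ->
    P (\bigcap_(i in [set` s]) (X i @^-1` A i)) =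
    (\prod_(i <- s) P (X i @^-1` A i))%E.

Definition identically_distributed (X : nat -> Omega -> T)
    (mu : probability T R) :=
  forall i A, measurable A -> P (X i @^-1` A) = mu A.

Definition iid (X : nat -> Omega -> T) (mu : probability T R) :=
  mutually_independent X /\ identically_distributed X mu.

Definition sigma_generated (X : nat -> Omega -> T) : set (set Omega) :=
  <<s \bigcup_i preimage_set_system setT (X i) measurable >>.

Definition independent_samples (X X' : nat -> Omega -> T) :=
  forall A B, sigma_generated X A -> sigma_generated X' B ->
    P (A `&` B) = (P A * P B)%E.

End independence.

Section wasserstein.
Context (R : realType) (d : nat) (N : 'rV[R]_d -> R).

Definition cball (x : Rd R d) (r : R) : set (Rd R d) :=
  [set x' | N (x - x') <= r].

Definition supp (nu : probability (Rd R d) R) : set (Rd R d) :=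
  [set x | forall r : R, 0 < r -> (0 < nu (cball x r))%E].

(* The marginal conditions force the total mass of a coupling. *)
Definition coupling (mu nu : {measure set (Rd R d) -> \bar R}) :
    set {measure set (Rd R d * Rd R d)%type -> \bar R} :=
  [set gamma | forall A, measurable A ->
    gamma (A `*` setT) = mu A /\ gamma (setT `*` A) = nu A].

Definition wasserstein (q : R) (mu nu : {measure set (Rd R d) -> \bar R}) :
    \bar R :=
  (ereal_inf [set \int[gamma]_z (N (z.1 - z.2) `^ q)%:E
             | gamma in coupling mu nu] `^ q^-1)%E.

(* Samples are indexed from 0: X_i is [xs i.-1], and only the first n (resp. m)
   terms of [xs] (resp. [ys]) are used. *)
Definition empirical (n : nat) (xs : nat -> Rd R d) :
    {measure set (Rd R d) -> \bar R} :=
  mscale (n%:R^-1)%:nng (msum (fun i => dirac (xs i)) n).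

Definition closer (x : Rd R d) (ys : nat -> Rd R d) : rel nat :=
  fun j j' => (N (x - ys j) < N (x - ys j')) ||
              ((N (x - ys j) == N (x - ys j')) && (j <= j')%N).

(* 0-based too: [neighbour m x ys l] is j^(l+1)(x), for l < m. *)
Definition neighbour (m : nat) (x : Rd R d) (ys : nat -> Rd R d) (l : nat) :
    nat :=
  nth 0%N (sort (closer x ys) (iota 0 m)) l.

Definition weight (n m k : nat) (xs ys : nat -> Rd R d) (j : nat) : R :=
  m%:R / (k * n)%:R *
  (\sum_(i < n) \sum_(l < k) (j == neighbour m (xs i) ys l))%N%:R.

Lemma weight_ge0 n m k xs ys j : 0 <= weight n m k xs ys j.
Proof. by rewrite mulr_ge0// divr_ge0. Qed.

Definition nn_empirical (n m k : nat) (xs ys : nat -> Rd R d) :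
    {measure set (Rd R d) -> \bar R} :=
  mscale (m%:R^-1)%:nng
    (msum (fun j => mscale (NngNum (weight_ge0 n m k xs ys j))
                           (dirac (ys j))) m).

End wasserstein.

(* Main.v *)
(** Fix L; since k / m tends to 0, k * L <= m for m large, and the second sample
    contains k disjoint blocks of length L. The k nearest neighbours of a point x
    are, in total, no farther than any k distinct sample points, in particular
    than the points nearest to x in each of the k blocks. Matching every X_i with
    its neighbours is a coupling, so W_q^q is at most the average over i and over
    the blocks of min_(j in block) |X_i - X'_j|^q. These terms all have the same
    expectation, that of min_(j < L) |X_0 - X'_j|^q, which depends on L only: this
    is where uniformity in n comes from. It remains to let L tend to infinity.

    That expectation tends to 0 by dominated convergence. Almost surely the
    second sample accumulates at X_0, which lies in supp(mu_X'). For the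
    domination, P(|X'| > t)^m0 <= C / t by Markov's inequality, so the minimum
    of |X'_j| over m0 * s indices has a tail O(t^-s), and hence a finite moment
    of order q once s > q. *)

Require Import Defs.
From HB Require Import structures.
From mathcomp Require Import all_boot all_order all_algebra.
From mathcomp Require Import all_classical all_reals all_analysis measurable_realfun.
From mathcomp Require Import ring lra.

Set Implicit Arguments.
Unset Strict Implicit.
Unset Printing Implicit Defensive.

Import Order.TTheory GRing.Theory Num.Theory.
Import numFieldNormedType.Exports.

Local Open Scope classical_set_scope.
Local Open Scope ring_scope.

(** * Continuity and Borel measurability of an arbitrary norm *)

Section norm.
Context (R : realType) (d : nat) (N : 'rV[R]_d -> R) (hN : is_norm N).

Lemma is_norm0 : N 0 = 0.
Proof. by rewrite -(scale0r 0) (norm_scale hN) normr0 mul0r. Qed.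

Lemma is_normN x : N (- x) = N x.
Proof. by rewrite -scaleN1r (norm_scale hN) normrN1 mul1r. Qed.

Lemma is_norm_distC x y : N (x - y) = N (y - x).
Proof. by rewrite -is_normN opprB. Qed.

Lemma is_norm_ge0 x : 0 <= N x.
Proof.
have := norm_triangle hN x (- x).
by rewrite subrr is_norm0 is_normN -mulr2n pmulrn_lge0.
Qed.

Lemma is_norm_dist_triangle z x y : N (x - y) <= N (x - z) + N (z - y).
Proof. by have := norm_triangle hN (x - z) (z - y); rewrite addrA subrK. Qed.

(** Expanding x in the canonical basis bounds N by the sup norm. This makes N continuous for the
    topology behind the Borel sigma-algebra of [Rd]. *)
Lemma is_norm_le_mx_norm :
  exists2 C : R, 0 < C & forall x : 'rV[R]_d, N x <= C * `|x|.
Proof.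
(* The term 1 keeps the constant positive even when d = 0. *)
exists (1 + \sum_(j < d) N (delta_mx 0 j)).
  by rewrite ltr_wpDr// sumr_ge0// => j _; exact: is_norm_ge0.
move=> x; apply: (@le_trans _ _ (\sum_(j < d) N (x 0 j *: delta_mx 0 j))).
  rewrite {1}(row_sum_delta x).
  elim/big_ind2 : _ => [|a b u v ab uv|//]; first by rewrite is_norm0.
  by rewrite (le_trans (norm_triangle hN _ _))// lerD.
rewrite mulrDl mul1r ler_wpDl// mulr_suml ler_sum// => j _.
rewrite (norm_scale hN) mulrC ler_wpM2l ?is_norm_ge0//.
rewrite [leRHS]mx_normrE.
exact: (le_bigmax _ (fun ij : 'I_1 * 'I_d => `|x ij.1 ij.2|) (ord0, j)).
Qed.

Lemma is_norm_sub_continuous c : continuous (fun x : 'rV[R]_d => N (x - c)).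
Proof.
have [C C0 NC] := is_norm_le_mx_norm.
move=> x; apply/(@cvgrPdist_lt _ _ _ (nbhs x) (nbhs_filter x)) => /= e e0.
apply/nbhs_ballP; exists (e / C); first by rewrite /= divr_gt0.
move=> y; rewrite -ball_normE/= ltr_pdivlMr// mulrC => xyC.
apply: le_lt_trans xyC; apply: le_trans (NC _).
rewrite ler_norml; apply/andP; split.
  by rewrite lerNl opprB lerBlDr (is_norm_distC x) is_norm_dist_triangle.
by rewrite lerBlDr is_norm_dist_triangle.
Qed.

Lemma measurable_is_norm_subl (c : Rd R d) :
  measurable_fun setT (fun x : Rd R d => N (x - c)).
Proof.
apply: (measurability _ (RGenInftyO.measurableE R)) => _ [_ [r ->] <-].
apply: sub_sigma_algebra; rewrite setTI.
have /continuousP := @is_norm_sub_continuous c; apply.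
by rewrite set_itvE; exact: open_lt.
Qed.

Lemma measurable_is_norm : measurable_fun setT (N : Rd R d -> R).
Proof.
apply: eq_measurable_fun (measurable_is_norm_subl 0) => x _.
by rewrite subr0.
Qed.

(** An enumeration of the vectors with rational coordinates; an integer that codes no such vector is
    sent to 0. *)
Definition ratrow (n : nat) : Rd R d :=
  if unpickle n is Some v then map_mx ratr (v : 'rV[rat]_d) else 0.

Lemma ratrow_dense x e : 0 < e -> exists n, N (x - ratrow n) < e.
Proof.
move=> e0; have [C C0 NC] := is_norm_le_mx_norm.
have eC0 : 0 < e / C by rewrite divr_gt0.
have h j : exists r : rat, `|x 0 j - ratr r| < e / C.
  have [|y [xy [r _ ry]]] := @dense_rat R (ball (x 0 j) (e / C)) _ (ball_open _ _).
    by exists (x 0 j); exact: ballxx.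
  by exists r; rewrite ry; move: xy; rewrite -ball_normE.
have [f fP] := choice h.
exists (pickle (\row_j f j)); rewrite /ratrow pickleK.
apply: le_lt_trans (NC _) _; rewrite mulrC -ltr_pdivlMr//.
rewrite [ltLHS]mx_normrE; apply/bigmax_ltP; split => // -[i j] _ /=.
by rewrite !mxE ord1.
Qed.

(* Countably many rational centres make the distance jointly measurable for the
   product sigma-algebra, without identifying it with the Borel sigma-algebra
   of the product space. *)
Lemma measurable_is_norm_sub {d'} {T : measurableType d'} (f g : T -> Rd R d) :
  measurable_fun setT f -> measurable_fun setT g ->
  measurable_fun setT (fun t => N (f t - g t)).
Proof.
move=> mf mg.
apply: (measurability _ (RGenInftyO.measurableE R)) => _ [_ [r ->] <-].
rewrite setTI set_itvE.
rewrite [X in measurable X](_ : _ = \bigcup_n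
    [set t | N (f t - ratrow n) + N (g t - ratrow n) < r]); last first.
  apply/seteqP; split => t /=.
    move=> Nr; have e0 : 0 < (r - N (f t - g t)) / 2 by rewrite divr_gt0// subr_gt0.
    have [n] := ratrow_dense (f t) e0; rewrite ltr_pdivlMr// ltrBrDr => Nn.
    exists n => //=; apply: le_lt_trans Nn.
    rewrite mulr_natr mulr2n -addrA lerD2l addrC.
    by rewrite (is_norm_distC (f t) (g t)) (is_norm_dist_triangle (f t))// addrC.
  move=> [n _ /=]; apply: le_lt_trans.
  by rewrite (is_norm_distC (g t)) is_norm_dist_triangle.
apply: bigcupT_measurable => n.
have := @measurable_fun_ltr _ _ _ setT
  (fun t => N (f t - ratrow n) + N (g t - ratrow n)) (cst r).
move=> /(_ _ _ measurableT [set true]); rewrite setTI; apply => //.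
by apply: measurable_funD; exact: measurableT_comp (measurable_is_norm_subl _) _.
Qed.

Lemma measurable_cball c r : measurable (cball N c r).
Proof.
rewrite -[cball _ _ _]setTI.
have -> : cball N c r = (fun x => N (x - c) <= r) @^-1` [set true].
  by apply/seteqP; split => x; rewrite /cball/= is_norm_distC.
apply: (measurable_fun_ler _ _ measurableT) => //.
exact: measurable_is_norm_subl.
Qed.

End norm.

(** * The complement of the support is null *)

Section support.
Context (R : realType) (d : nat) (N : 'rV[R]_d -> R) (hN : is_norm N).

Lemma cball_subset c x r s : N (c - x) <= r ->
  cball N x s `<=` cball N c (r + s).
Proof.
move=> cx y; rewrite /cball/= => xy.
by rewrite (le_trans (is_norm_dist_triangle hN x c y))// lerD.
Qed.

Lemma notin_supp (mu : probability (Rd R d) R) x r :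
  0 < r -> mu (cball N x r) = 0%E -> ~ supp N mu x.
Proof. by move=> r0 mux /(_ _ r0); rewrite mux ltxx. Qed.

(** A point outside the support is the centre of a null ball, hence belongs to a null ball with
    rational centre and radius 1/(p+1). There are countably many of these. *)
Lemma supp_negligible (mu : probability (Rd R d) R) :
  mu.-negligible (~` supp N mu).
Proof.
pose rad p : R := p.+1%:R^-1.
pose B n p : set (Rd R d) :=
  if mu (cball N (ratrow R d n) (rad p)) == 0%E then cball N (ratrow R d n) (rad p)
  else set0.
have B0 n p : mu.-negligible (B n p).
  rewrite /B; case: ifPn => [/eqP B0|_]; last exact: negligible_set0.
  by exists (cball N (ratrow R d n) (rad p)); split => //; exact: measurable_cball.
apply: (@negligibleS _ _ _ mu (\bigcup_n \bigcup_p B n p)); last first.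
  by apply: negligible_bigcup => n; exact: negligible_bigcup.
move=> x; rewrite /supp/= -existsNE => -[r /not_implyP[r0 /negP]].
rewrite -leNgt => mux.
have [p pr] : exists p, rad p < r / 2.
  by have [|p] := @ltr_add_invr R 0 (r / 2); rewrite ?divr_gt0// add0r; exists p.
have p0 : 0 < rad p by rewrite invr_gt0.
have [n xn] := ratrow_dense hN x p0.
exists n => //; exists p => //; rewrite /B.
have sub : cball N (ratrow R d n) (rad p) `<=` cball N x r.
  apply: subset_trans (cball_subset (ltW xn)) _ => y.
  rewrite /cball/= => /le_trans; apply.
  by rewrite [leRHS](splitr r) lerD// ltW.
rewrite ifT; last first.
  rewrite -measure_le0 (le_trans _ mux)// le_measure// inE; exact: measurable_cball.
by rewrite /cball/= (is_norm_distC hN) ltW.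
Qed.

End support.

(** * Laws of sequences on the product sigma-algebra *)

Section path_space.
Context d (T : measurableType d).

Definition cylinder (L : nat) (A : nat -> set T) : set (nat -> T) :=
  [set z | forall j, (j < L)%N -> A j (z j)].

Definition cylinders : set (set (nat -> T)) :=
  [set C | exists L A, (forall j, measurable (A j)) /\ C = cylinder L A].

(** The product sigma-algebra on sequences. Its generators, the cylinders, form a pi-system, so a
    probability law is determined by its values on them. *)
Definition path_space := g_sigma_algebraType cylinders.

(** Padding with the full space brings two cylinders to a common length before they are
    intersected. *)
Lemma cylinder_le L L' A : (L <= L')%N ->
  cylinder L A = cylinder L' (fun j => if (j < L)%N then A j else setT).
Proof.
move=> LL'; apply/seteqP; split => z /= h j jL.
  by case: ifPn => //; exact: h.
by have := h j (leq_trans jL LL'); rewrite jL.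
Qed.

Lemma cylinders_setI : setI_closed cylinders.
Proof.
move=> _ _ [L [A [mA ->]]] [L' [A' [mA' ->]]].
rewrite (cylinder_le A (leq_maxl L L')) (cylinder_le A' (leq_maxr L L')).
exists (maxn L L'), (fun j => (if (j < L)%N then A j else setT) `&`
                             (if (j < L')%N then A' j else setT)); split.
  by move=> j; apply: measurableI; case: ifPn.
apply/seteqP; split => [z [h h'] j jL|z h]; first by split; [exact: h|exact: h'].
by split => j /h[].
Qed.

Lemma measurable_coord j : measurable_fun setT (fun z : path_space => z j).
Proof.
move=> _ A mA; rewrite setTI; apply: sub_sigma_algebra.
exists j.+1, (fun i => if i == j then A else setT); split.
  by move=> i; case: ifPn.
apply/seteqP; split => [z /= zA i _|z /(_ j (ltnSn j))/=]; last by rewrite eqxx.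
by case: eqP => // ->.
Qed.

End path_space.
Arguments cylinders {d} T.

Section path_law.
Context d d' (Omega : measurableType d') (T : measurableType d).

Definition path (Z : nat -> {mfun Omega >-> T}) : Omega -> path_space T :=
  fun w j => Z j w.

Lemma measurable_path Z : measurable_fun setT (path Z).
Proof.
apply: (@measurability _ _ _ (path_space T) _ _ (cylinders T) erefl).
move=> _ [_ [L [A [mA ->]]] <-].
rewrite setTI [X in measurable X](_ : _ =
    \bigcap_(j in [set j | (j < L)%N]) (Z j @^-1` A j)); last first.
  by apply/seteqP; split => w /= h j; exact: h.
apply: bigcap_measurableType => // j _.
by rewrite -[X in measurable X]setTI; exact: measurable_funP.
Qed.

HB.instance Definition _ Z :=
  isMeasurableFun.Build _ _ Omega (path_space T) (path Z) (measurable_path Z).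

Context (R : realType) (P : probability Omega R).

Definition same_fdd (Z Z' : nat -> {mfun Omega >-> T}) :=
  forall (L : nat) (A : nat -> set T), (forall j, measurable (A j)) ->
    P (\bigcap_(j in `I_L) (Z j @^-1` A j)) =
    P (\bigcap_(j in `I_L) (Z' j @^-1` A j)).

(** The two path laws agree on the pi-system of cylinders, hence everywhere, and both integrals are
    taken against this common law. *)
Lemma ge0_integral_same_fdd Z Z' (f : path_space T -> \bar R) :
  same_fdd Z Z' -> measurable_fun setT f -> (forall z, 0 <= f z)%E ->
  (\int[P]_w f (path Z w) = \int[P]_w f (path Z' w))%E.
Proof.
move=> ZZ' mf f0.
have e Y : (\int[P]_w f (path Y w) = \int[distribution P (path Y)]_z f z)%E.
  by rewrite ge0_integral_distribution.
rewrite !e; apply: eq_measure_integral => C mC _.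
refine (@measure_unique _ R (path_space T) (cylinders T) (fun=> setT) erefl
  _ _ _ (distribution P (path Z)) (distribution P (path Z')) _ _ _ mC).
- exact: cylinders_setI.
- move=> _; exists 0%N, (fun=> setT); split => //.
  by apply/seteqP; split.
- by rewrite bigcup_const.
- by move=> _ [L [A [mA ->]]]; exact: ZZ'.
- by move=> _; rewrite (le_lt_trans (probability_le1 _ _))// ltry.
Qed.

End path_law.

(** * Minimum of the first terms of a real sequence *)

Definition least (R : realType) (L : nat) (a : nat -> R) : R :=
  \big[Num.min/a 0%N]_(j < L) a j.

Section least.
Context (R : realType).
Implicit Types (a : nat -> R) (L : nat).

Lemma least_le L a j : (j < L)%N -> least L a <= a j.
Proof. by move=> jL; exact: (bigmin_le _ (Ordinal jL) (fun i : 'I_L => a i)). Qed.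

(** The default value [a 0] is itself one of the terms once L > 0, so it does not disturb the
    minimum. *)
Lemma least_eq L a : (0 < L)%N -> exists2 j, (j < L)%N & least L a = a j.
Proof.
move=> L0; pose j0 := Ordinal L0.
exists [arg min_(i < j0) a i]%O => //.
have h (i : 'I_L) : true -> a i <= Num.max (a 0%N) (a i) by rewrite le_max lexx orbT.
apply/eqP; rewrite eq_le least_le//=.
case: arg_minP => //= i _ imin; apply/bigmin_geP; split; first exact: (imin j0).
by move=> j _; exact: imin.
Qed.

Lemma least_gtP L a t : (0 < L)%N ->
  reflect (forall j, (j < L)%N -> t < a j) (t < least L a).
Proof.
move=> L0; apply: (iffP idP) => [h j jL|h].
  exact: lt_le_trans h (least_le _ _).
by have [j jL ->] := least_eq a L0; exact: h.
Qed.

Lemma le_least L L' a : (0 < L)%N -> (L <= L')%N -> least L' a <= least L a.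
Proof.
move=> L0 LL'; have [j jL ->] := least_eq a L0.
exact/least_le/leq_trans/LL'.
Qed.

Lemma least_ge0 L a : (forall j, 0 <= a j) -> 0 <= least L a.
Proof. by move=> a0; apply/bigmin_geP; split => // j _. Qed.

End least.

(** * Minimality of the nearest neighbours *)

(** By induction on s: its head either is the head of t, or precedes it in the order and so costs no
    more. *)
Lemma sum_take_sorted_le (T : eqType) (R : realType) (leT : rel T) (c : T -> R)
    (s t : seq T) : transitive leT -> {homo c : x y / leT x y >-> x <= y} ->
  sorted leT s -> subseq t s ->
  \sum_(x <- take (size t) s) c x <= \sum_(x <- t) c x.
Proof.
move=> leT_tr c_homo; elim: s t => [|x s IH] [|y t]; rewrite ?big_nil//.
move=> xs; have s_sorted := path_sorted xs.
rewrite [take _ _]/= !big_cons [subseq _ _]/=; case: eqP => [->|_] ts.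
  by rewrite lerD// IH.
have xy : leT x y.
  move/(order_path_min leT_tr)/allP : xs; apply.
  exact: mem_subseq ts _ (mem_head _ _).
by rewrite lerD ?c_homo// IH//; apply: subseq_trans ts; exact: subseq_cons.
Qed.

Section nearest_neighbours.
Context (R : realType) (d : nat) (N : 'rV[R]_d -> R) (hN : is_norm N).
Implicit Types (x : Rd R d) (xs ys : nat -> Rd R d).

Lemma closer_trans x ys : transitive (closer N x ys).
Proof.
move=> j i l /orP[ij|/andP[/eqP ij ij']] /orP[jl|/andP[/eqP jl jl']];
  rewrite /closer.
- by rewrite (lt_trans ij).
- by rewrite -jl ij.
- by rewrite ij jl.
- by rewrite ij jl eqxx (leq_trans ij') ?orbT.
Qed.

Lemma closer_total x ys : total (closer N x ys).
Proof.
move=> i j; rewrite /closer; case: ltgtP => //= _; exact: leq_total.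
Qed.

Lemma closer_le x ys i j : closer N x ys i j -> N (x - ys i) <= N (x - ys j).
Proof. by case/orP => [/ltW//|/andP[/eqP ->]]. Qed.

Lemma neighbour_lt m x ys l : (l < m)%N -> (neighbour N m x ys l < m)%N.
Proof.
move=> lm; have : neighbour N m x ys l \in iota 0 m.
  by rewrite -(mem_sort (closer N x ys)) mem_nth// size_sort size_iota.
by rewrite mem_iota.
Qed.

(** The neighbours are the first k entries of the sorted index list s. The k distinct values of f,
    listed in the order of s, form a subsequence t of s, and [sum_take_sorted_le] compares the
    two. *)
Lemma sum_neighbour_le m k x ys (c : R -> R) (f : nat -> nat) :
  {in Num.nneg &, {homo c : r s / r <= s}} ->
  {in gtn k &, injective f} -> {in gtn k, forall b, (f b < m)%N} ->
  \sum_(l < k) c (N (x - ys (neighbour N m x ys l))) <=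
  \sum_(b < k) c (N (x - ys (f b))).
Proof.
move=> c_homo f_inj fm; pose s := sort (closer N x ys) (iota 0 m).
pose fs := map f (iota 0 k); pose t := [seq j <- s | j \in fs].
have fs_uniq : uniq fs.
  by rewrite map_inj_in_uniq ?iota_uniq// => b b' /[!mem_iota]; exact: f_inj.
have t_fs : perm_eq t fs.
  apply: uniq_perm => //; first by rewrite filter_uniq// sort_uniq iota_uniq.
  move=> j; rewrite mem_filter mem_sort mem_iota/= add0n.
  by apply: andb_idr => /mapP[b /[!mem_iota] bk ->]; exact: fm.
have size_t : size t = k by rewrite (perm_size t_fs) size_map size_iota.
have s_sorted : sorted (closer N x ys) s by exact/sort_sorted/closer_total.
have := @sum_take_sorted_le _ R _ (fun j => c (N (x - ys j))) s t
  (@closer_trans x ys) _ s_sorted (filter_subseq _ _).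
have km : (k <= size s)%N.
  by rewrite -size_t size_filter count_size.
rewrite size_t (perm_big _ t_fs) big_map/=.
rewrite (_ : iota 0 k = index_iota 0 k) ?/index_iota ?subn0//.
rewrite -{2}(subn0 k) big_mkord => h; apply: le_trans (h _); last first.
  by move=> i j /closer_le ij; apply: c_homo => //; rewrite nnegrE is_norm_ge0.
rewrite (big_nth 0%N) size_take_min (minn_idPl km) big_mkord.
by rewrite ler_sum// => l _; rewrite nth_take.
Qed.

(* The minima over k disjoint blocks of length L are attained at k distinct
   indices, hence dominate the k smallest distances in total. *)
Lemma sum_neighbour_blocks_le m k L x ys (c : R -> R) :
  {in Num.nneg &, {homo c : r s / r <= s}} -> (0 < L)%N -> (k * L <= m)%N ->
  \sum_(l < k) c (N (x - ys (neighbour N m x ys l))) <=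
  \sum_(b < k) least L (fun j => c (N (x - ys (b * L + j)%N))).
Proof.
move=> c_homo L0 kLm.
have /choice[g gP] : forall b, exists j, (j < L)%N /\
    least L (fun j => c (N (x - ys (b * L + j)%N))) =
    c (N (x - ys (b * L + j)%N)).
  move=> b.
  by have [j] := least_eq (fun j => c (N (x - ys (b * L + j)%N))) L0; exists j.
have gL b : (g b < L)%N by have [] := gP b.
under [leRHS]eq_bigr do rewrite (gP _).2.
apply: (@sum_neighbour_le m k x ys c (fun b => (b * L + g b)%N)) => //.
- move=> b b' _ _ /(congr1 (divn^~ L)).
  by rewrite !divnMDl// !(divn_small (gL _)) !addn0.
- move=> b; rewrite inE => bk; apply: leq_trans kLm.
  by apply: (@leq_trans (b.+1 * L)); rewrite ?leq_mul2r ?bk ?orbT// mulSn addnC ltn_add2r.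
Qed.

End nearest_neighbours.

(** * The neighbour coupling and its transport cost *)

(** After exchanging the sums, each pair (i, l) keeps the single index j = nu i l, which is in
    range. Weights that count occurrences thus become a sum over occurrences. *)
Lemma sum_count_eq (R : pzSemiRingType) n m k (nu : nat -> nat -> nat) (g : nat -> R) :
  (forall i l, (l < k)%N -> (nu i l < m)%N) ->
  \sum_(j < m) (\sum_(i < n) \sum_(l < k) (val j == nu i l))%N%:R * g j =
  \sum_(i < n) \sum_(l < k) g (nu i l).
Proof.
move=> num; under eq_bigr do rewrite natr_sum mulr_suml.
rewrite exchange_big; apply: eq_bigr => i _ /=.
under eq_bigr do rewrite natr_sum mulr_suml.
rewrite exchange_big; apply: eq_bigr => l _ /=.
rewrite (bigD1 (Ordinal (num i l (ltn_ord l))))//= eqxx mul1r big1 ?addr0// => j.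
by rewrite -val_eqE/= => /negPf ->; rewrite mul0r.
Qed.

Section neighbour_coupling.
Context (R : realType) (d : nat) (N : 'rV[R]_d -> R) (hN : is_norm N).
Implicit Types (xs ys : nat -> Rd R d).

Definition neighbour_coupling (n m k : nat) xs ys :
    {measure set (Rd R d * Rd R d)%type -> \bar R} :=
  mscale (n%:R^-1)%:nng (msum (fun i => mscale (k%:R^-1)%:nng
    (msum (fun l => dirac (xs i, ys (neighbour N m (xs i) ys l))) k)) n).

(** The factor m of the weights cancels the 1/m in front, and [sum_count_eq] regroups them by pairs
    (i, l). In this form the measure is visibly the second marginal of the coupling. *)
Lemma nn_empiricalE n m k xs ys (A : set (Rd R d)) : (0 < k <= m)%N ->
  nn_empirical N n m k xs ys A =
  (n%:R^-1 * \sum_(i < n) k%:R^-1 *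
    \sum_(l < k) \1_A (ys (neighbour N m (xs i) ys l)))%:E.
Proof.
move=> /andP[k0 km]; rewrite /nn_empirical/= /mscale/= /msum/=.
under eq_bigr do rewrite /mscale/= /dirac/= -EFinM.
rewrite sumEFin -EFinM; congr EFin.
have m0 : (m%:R : R) != 0 by rewrite pnatr_eq0 -lt0n (leq_trans k0).
rewrite -[X in _ = _ * X]mulr_sumr [RHS]mulrA -invfM -natrM (mulnC n) /weight.
under eq_bigr do rewrite -!mulrA.
rewrite -!mulr_sumr mulKf//.
congr (_ * _).
apply: (@sum_count_eq R n m k (fun i l => neighbour N m (xs i) ys l)
  (fun j => \1_A (ys j))).
by move=> i l lk; apply: neighbour_lt; exact: leq_trans lk km.
Qed.

Lemma coupling_neighbour n m k xs ys : (0 < k <= m)%N ->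
  coupling (empirical n xs) (nn_empirical N n m k xs ys)
    (neighbour_coupling n m k xs ys).
Proof.
move=> km A mA; have k0 : (k%:R : R) != 0 by rewrite pnatr_eq0 -lt0n; case/andP: km.
rewrite nn_empiricalE// /empirical /neighbour_coupling/= /mscale/= /msum/=.
rewrite /mscale/= /msum/= /dirac; split.
  (* First marginal: the average over l is that of k equal values, with k > 0. *)
  have AT (z w : Rd R d) : \1_(A `*` setT) (z, w) = \1_A z :> R.
    by rewrite !indicE in_setX in_setT andbT.
  congr (_ * _)%E; apply: eq_bigr => i _; under eq_bigr do rewrite AT.
  by rewrite sumEFin -EFinM big_const_ord iter_addr_0 -[\1_A _ *+ k]mulr_natl mulKf.
have TA (z w : Rd R d) : \1_(setT `*` A) (z, w) = \1_A w :> R.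
  by rewrite !indicE in_setX in_setT.
rewrite EFinM -sumEFin; congr (_ * _)%E; apply: eq_bigr => i _.
by under eq_bigr do rewrite TA; rewrite sumEFin -EFinM.
Qed.

Lemma measurable_powR_norm_sub q {d'} {T : measurableType d'} (f g : T -> Rd R d) :
  measurable_fun setT f -> measurable_fun setT g ->
  measurable_fun setT (fun t => (N (f t - g t) `^ q)%:E).
Proof.
move=> mf mg; apply/measurable_EFinP.
have h := measurable_is_norm_sub hN mf mg.
exact: (measurableT_comp (measurable_powR q) h).
Qed.

Lemma integral_neighbour_coupling n m k xs ys q :
  (\int[neighbour_coupling n m k xs ys]_z (N (z.1 - z.2) `^ q)%:E)%E =
  (n%:R^-1 * \sum_(i < n) k%:R^-1 *
    \sum_(l < k) N (xs i - ys (neighbour N m (xs i) ys l)) `^ q)%:E.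
Proof.
have mf : measurable_fun setT (fun z : Rd R d * Rd R d => (N (z.1 - z.2) `^ q)%:E).
  exact: (measurable_powR_norm_sub q measurable_fst measurable_snd).
have f0 z : setT z -> (0 <= (N (z.1 - z.2) `^ q)%:E)%E by rewrite lee_fin powR_ge0.
rewrite /neighbour_coupling ge0_integral_mscale//= ge0_integral_measure_sum//.
rewrite EFinM -sumEFin; congr (_ * _)%E; apply: eq_bigr => i _.
rewrite ge0_integral_mscale//= ge0_integral_measure_sum//.
rewrite EFinM -sumEFin; congr (_ * _)%E; apply: eq_bigr => l _.
by rewrite integral_dirac// diracT mul1e.
Qed.

Lemma wasserstein_powR_le (mu nu : {measure set (Rd R d) -> \bar R}) gamma q :
  1 <= q -> coupling mu nu gamma ->
  (wasserstein N q mu nu `^ q <= \int[gamma]_z (N (z.1 - z.2) `^ q)%:E)%E.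
Proof.
move=> q1 cg; have q0 : q != 0 by rewrite gt_eqF// (lt_le_trans _ q1).
(* The exponents 1/q and q cancel because the infimum of nonnegative costs is nonnegative. *)
rewrite /wasserstein -poweRrM mulVf// poweRe1; last first.
  apply: le_ereal_inf_tmp => _ [g _ <-]; apply: integral_ge0 => z _.
  by rewrite lee_fin powR_ge0.
by apply: ereal_inf_lbound; exists gamma.
Qed.

Lemma wasserstein_neighbour_le n m k L xs ys q : 1 <= q -> (0 < k <= m)%N ->
  (0 < L)%N -> (k * L <= m)%N ->
  (wasserstein N q (empirical n xs) (nn_empirical N n m k xs ys) `^ q <=
   (n%:R^-1 * \sum_(i < n) k%:R^-1 *
     \sum_(b < k) least L (fun j => N (xs i - ys (b * L + j)%N) `^ q))%:E)%E.
Proof.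
move=> q1 km L0 kLm.
apply: le_trans (wasserstein_powR_le q1 (coupling_neighbour n xs ys km)) _.
rewrite integral_neighbour_coupling lee_fin ler_wpM2l ?invr_ge0//.
rewrite ler_sum// => i _; rewrite ler_wpM2l ?invr_ge0//.
apply: (@sum_neighbour_blocks_le R d N hN m k L (xs i) ys (fun r => r `^ q)) => //.
by apply: ge0_ler_powR; rewrite (le_trans _ q1).
Qed.

End neighbour_coupling.

(** * Integrals of averages, measurability of minima *)

Section integral.
Context d (T : measurableType d) (R : realType) (mu : {measure set T -> \bar R}).

(* No measurability is required: it is not known for the Wasserstein distance as
   a function of the samples. *)
Lemma ge0_le_integral_any (f g : T -> \bar R) :
  (forall x, 0 <= f x)%E -> (forall x, f x <= g x)%E ->
  (\int[mu]_x f x <= \int[mu]_x g x)%E.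
Proof.
move=> f0 fg; have g0 x : (0 <= g x)%E by rewrite (le_trans (f0 x)).
rewrite !ge0_integralTE//; apply: ereal_sup_le => _ [h /= hf <-].
by exists h => // x; rewrite (le_trans (hf x)).
Qed.

(** Linearity gives it, whatever the dependence between the terms. Applied to the points X_i and to
    the blocks, it removes n and k from the bound. *)
Lemma integral_average (n : nat) (f : nat -> T -> R) (c : R) : (0 < n)%N ->
  (forall i, measurable_fun setT (f i)) -> (forall i x, 0 <= f i x) ->
  (forall i, \int[mu]_x (f i x)%:E = c%:E)%E ->
  (\int[mu]_x (n%:R^-1 * \sum_(i < n) f i x)%:E = c%:E)%E.
Proof.
move=> n0 mf f0 fc.
under eq_integral do rewrite EFinM -sumEFin.
rewrite ge0_integralZl_EFin//; last first.
- by apply: emeasurable_sum => i; exact/measurable_EFinP.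
- by move=> x _; apply: sume_ge0 => i _; rewrite lee_fin.
rewrite ge0_integral_sum//; last first.
- by move=> i x _; rewrite lee_fin.
- by move=> i; exact/measurable_EFinP.
under eq_bigr do rewrite fc.
rewrite sumEFin -EFinM big_const_ord iter_addr_0 -[c *+ n]mulr_natl mulKf//.
by rewrite pnatr_eq0 -lt0n.
Qed.

Lemma measurable_least (L : nat) (f : nat -> T -> R) :
  (forall j, measurable_fun setT (f j)) ->
  measurable_fun setT (fun x => least L (f ^~ x)).
Proof.
(* The default value becomes an arbitrary g, since the induction shifts f and would change [f 0]. *)
move=> mf; rewrite /least; move: (f 0%N) (mf 0%N) => g mg.
elim: L f mf => [|L IH] f mf; first by under eq_fun do rewrite big_ord0.
under eq_fun do rewrite big_ord_recl.
by apply: measurable_minr => //; exact: (IH (fun j => f j.+1)).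
Qed.

End integral.

(** * Joint law of one point and a block of the other sample *)

Section two_samples.
Context (R : realType) d (T : measurableType d)
  dO (Omega : measurableType dO) (P : probability Omega R).

Lemma iid_bigcap (X : nat -> {RV P >-> T}) (mu : probability T R)
    (s : seq nat) (A : nat -> set T) : iid P X mu -> uniq s ->
  (forall j, measurable (A j)) ->
  P (\bigcap_(j in [set` s]) (X j @^-1` A j)) = (\prod_(j <- s) mu (A j))%E.
Proof.
move=> [Xind Xid] us mA; rewrite Xind//; apply: eq_bigr => j _.
exact: Xid.
Qed.

Lemma sigma_generated_bigcap (X : nat -> {RV P >-> T}) (D : set nat)
    (A : nat -> set T) : (forall j, measurable (A j)) ->
  sigma_generated X (\bigcap_(j in D) (X j @^-1` A j)).
Proof.
move=> mA.
pose G := \bigcup_i preimage_set_system setT (X i) (@measurable _ T).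
apply: (@bigcap_measurableType _ (g_sigma_algebraType G)) => j _.
apply: sub_sigma_algebra; exists j => //; exists (A j) => //.
by rewrite setTI.
Qed.

(* Position 0 carries a point of the first sample, the following ones a block
   of the second sample. *)
Definition splice (X X' : nat -> {RV P >-> T}) (i s j : nat) :
    {mfun Omega >-> T} :=
  if j is j'.+1 then X' (s + j')%N else X i.

(** Independence of the samples splits off position 0, and mutual independence splits the block.
    Neither i nor s survives in the product: every point sees every block with the same joint
    law. *)
Lemma splice_law (X X' : nat -> {RV P >-> T}) (mu mu' : probability T R)
    i s L (A : nat -> set T) :
  iid P X mu -> iid P X' mu' -> independent_samples P X X' ->
  (forall j, measurable (A j)) ->
  P (\bigcap_(j in `I_L.+1) (splice X X' i s j @^-1` A j)) =
  (mu (A 0%N) * \prod_(0 <= j < L) mu' (A j.+1))%E.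
Proof.
move=> hX hX' XX' mA.
(* Sets re-indexed by the positions in the second sample; the truncated subtraction is only read at
   j >= s. *)
pose A' j := A (j - s).+1.
have mA' j : measurable (A' j) by exact: mA.
have -> : \bigcap_(j in `I_L.+1) (splice X X' i s j @^-1` A j) =
    \bigcap_(j in [set i]) (X j @^-1` A 0%N) `&`
    \bigcap_(j in [set` iota s L]) (X' j @^-1` A' j).
  apply/seteqP; split => [w h|w [h h'] [|j] jL].
  - split => [j -> |j]; first exact: (h 0%N).
    rewrite /= mem_iota => /andP[sj jsL].
    by have := h (j - s).+1; rewrite /A'/= subnKC//; apply; rewrite ltnS ltn_subLR.
  - exact: h.
  - have := h' (s + j)%N; rewrite /A' addKn/=; apply.
    by rewrite mem_iota leq_addr ltn_add2l.
rewrite XX'; [|exact: sigma_generated_bigcap|exact: sigma_generated_bigcap].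
have -> : [set i] = [set` [:: i]] by apply/seteqP; split => j /=; rewrite inE => /eqP.
rewrite (iid_bigcap (A := fun=> A 0%N) hX)// big_seq1 (iid_bigcap hX') ?iota_uniq//.
congr (_ * _)%E; rewrite -[s in iota s L]addn0 iotaDl big_map/= /index_iota subn0.
by apply: eq_bigr => j _; rewrite /A' addKn.
Qed.

Lemma splice_same_fdd (X X' : nat -> {RV P >-> T}) (mu mu' : probability T R)
    i s i' s' :
  iid P X mu -> iid P X' mu' -> independent_samples P X X' ->
  same_fdd P (splice X X' i s) (splice X X' i' s').
Proof.
move=> hX hX' XX' [|L] A mA; last by rewrite !(splice_law _ _ _ hX hX').
by rewrite II0 !bigcap_set0.
Qed.

End two_samples.

(** * Finite moments from tail bounds *)

Section moments.
Context d (T : measurableType d) (R : realType) (P : probability T R).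

Lemma measurable_gt (f : T -> R) t : measurable_fun setT f ->
  measurable [set x | t < f x].
Proof.
move=> mf; rewrite -[X in measurable X]setTI.
exact: (measurable_fun_ltr (measurable_cst t) mf measurableT (Y:=[set true])).
Qed.

(** Markov's inequality. *)
Lemma integral_ge_tail (f : T -> R) (t : R) : measurable_fun setT f ->
  (forall x, 0 <= f x) -> 0 <= t ->
  (t%:E * P [set x | (t < f x)%R] <= \int[P]_x (f x)%:E)%E.
Proof.
move=> mf f0 t0.
have mA := measurable_gt t mf.
have <- : (\int[P]_x (t%:E * (\1_[set x | (t < f x)%R] x)%:E) =
           t%:E * P [set x | (t < f x)%R])%E.
  by rewrite ge0_integralZl_EFin//= ?integral_indic ?setIT//; exact/measurable_EFinP.
apply: ge0_le_integral_any => x; first by rewrite mule_ge0 ?lee_fin.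
rewrite -EFinM lee_fin indicE; case: (boolP (x \in _)) => [|_].
  by rewrite inE/= mulr1 => /ltW.
by rewrite mulr0 f0.
Qed.

(** If 2^i < x <= 2^(i+1), the term of index i alone dominates x^q; if x <= 1, the constant 1
    does. *)
Lemma dyadic_powR_le (q x : R) (a n : nat) : 0 <= q -> q <= a%:R -> 0 <= x ->
  x <= 2 ^+ n ->
  x `^ q <= 1 + \sum_(0 <= i < n) 2 ^+ (i.+1 * a) * (2 ^+ i < x)%R%:R.
Proof.
move=> q0 qa x0; elim: n => [|n IH] xn.
  rewrite big_geq// addr0; apply: (@le_trans _ _ (1 `^ q)); last by rewrite powR1.
  by rewrite ge0_ler_powR ?nnegrE.
rewrite big_nat_recr//= addrA; have [xn'|xn'] := leP x (2 ^+ n).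
  by rewrite mulr0 addr0 IH.
rewrite mulr1 ler_wpDl//.
  by rewrite addr_ge0// sumr_ge0// => i _; rewrite mulr_ge0// exprn_ge0.
apply: (@le_trans _ _ ((2 ^+ n.+1) `^ q)).
  by rewrite ge0_ler_powR// nnegrE exprn_ge0.
rewrite exprM -[leRHS]powR_mulrn ?exprn_ge0//.
by rewrite ler_powR// exprn_ege1// ler1n.
Qed.

(** The dyadic bound is integrated term by term: weights of order t^a against a tail of order
    t^-(a+1), at t = 2^i, leave a geometric series. *)
Lemma integral_powR_tail_lty (f : T -> R) (K q : R) (a : nat) :
  measurable_fun setT f -> (forall x, 0 <= f x) -> 0 <= q -> q <= a%:R ->
  (forall t : R, (1 <= t)%R -> P [set x | (t < f x)%R] <= (K / t ^+ a.+1)%:E)%E ->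
  (\int[P]_x (f x `^ q)%:E < +oo)%E.
Proof.
move=> mf f0 q0 qa tail.
have mA t := measurable_gt t mf.
pose g i x : \bar R :=
  ((2 ^+ (i.+1 * a))%R%:E * (\1_[set x | (2 ^+ i < f x)%R] x)%:E)%E.
have g0 i x : (0 <= g i x)%E by rewrite /g mule_ge0 ?lee_fin ?exprn_ge0.
have mg i : measurable_fun setT (g i).
  apply/measurable_EFinP; apply: measurable_funM => //.
have fg x : ((f x `^ q)%:E <= 1 + \sum_(i <oo) g i x)%E.
  have [n fn] : exists n, f x <= 2 ^+ n.
    exists (Num.bound (f x)); rewrite (le_trans (ltW (archi_boundP (f0 x))))//.
    by rewrite -natrX ler_nat ltnW// ltn_expl.
  have := dyadic_powR_le q0 qa (f0 x) fn; rewrite -lee_fin => /le_trans; apply.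
  rewrite EFinD leeD2l// -sumEFin.
  apply: le_trans (nneseries_lim_ge n _); last by move=> i _ _; exact: g0.
  apply: lee_sum => i _; rewrite /g -EFinM lee_fin indicE.
  by rewrite ler_wpM2l ?exprn_ge0//; case: (boolP (_ < _)) => h//; rewrite mem_set.
apply: (@le_lt_trans _ _ (\int[P]_x (1 + \sum_(i <oo) g i x))%E).
  by apply: ge0_le_integral_any => // x; rewrite lee_fin powR_ge0.
rewrite ge0_integralD//; last 2 first.
- by move=> x _; apply: nneseries_ge0 => i _ _; exact: g0.
- by apply: ge0_emeasurable_sum => //.
rewrite integral_cst//= probability_setT mule1 integral_nneseries//.
rewrite lte_add_pinfty ?ltry//.
(* The i-th term is at most 2^((i+1)a) K / 2^(i(a+1)) = 2^a K / 2^i, written over 2^(i+1) to fit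
   [epsilon_trick0]. *)
apply: (@le_lt_trans _ _
    (\sum_(i <oo) ((2 ^+ a * K * 2) / (2 ^ i.+1)%:R)%:E)%E).
  apply: lee_nneseries => i; first by move=> _ _; apply: integral_ge0 => x _.
  move=> _; rewrite /g ge0_integralZl_EFin//= ?exprn_ge0//; last first.
    exact/measurable_EFinP.
  rewrite integral_indic// setIT.
  have u1 : 1 <= 2 ^+ i :> R by rewrite exprn_ege1// ler1n.
  have p0 : (0 <= (2 ^+ (i.+1 * a))%R%:E :> \bar R)%E by rewrite lee_fin exprn_ge0.
  rewrite (le_trans (lee_wpmul2l p0 (tail _ u1)))//.
  rewrite -EFinM lee_fin natrX exprM !exprS exprMn.
  have : 2 ^+ i != 0 :> R by rewrite expf_neq0.
  move: (2 ^+ i) => u u0; rewrite le_eqVlt; apply/predU1l.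
  by field; rewrite u0 expf_neq0.
apply: le_lt_trans (epsilon_trick0 _ _) _; last exact: ltry.
(* The tail bound at t = 1 puts K above a probability, so K >= 0. *)
have := tail 1 (lexx _); rewrite expr1n divr1 => /(le_trans (measure_ge0 _ _)).
by rewrite lee_fin => K0; rewrite !mulr_ge0// exprn_ge0.
Qed.

End moments.

(** The sum is at most twice the larger of x and y. *)
Lemma powR_add_le (R : realType) (q x y : R) : 0 <= q -> 0 <= x -> 0 <= y ->
  (x + y) `^ q <= 2 `^ q * (x `^ q + y `^ q).
Proof.
move=> q0 x0 y0; wlog xy : x y x0 y0 / x <= y => [h|].
  by have [/h|/ltW/h] := leP x y; [exact|rewrite addrC (addrC (y `^ q)); exact].
apply: (@le_trans _ _ ((2 * y) `^ q)).
  rewrite ge0_ler_powR ?nnegrE ?addr_ge0 ?mulr_ge0//.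
  by rewrite mulr_natl mulr2n lerD2r.
by rewrite powRM// ler_wpM2l ?powR_ge0// lerDr powR_ge0.
Qed.

(** * Distance from X_0 to the second sample: density and domination *)

Section nearest_point.
Context (R : realType) (d : nat) (N : 'rV[R]_d -> R) (hN : is_norm N)
  (dO : measure_display) (Omega : measurableType dO) (P : probability Omega R)
  (muX muX' : probability (Rd R d) R) (X X' : nat -> {RV P >-> Rd R d})
  (hX : iid P X muX) (hX' : iid P X' muX') (hXX' : independent_samples P X X').

Lemma iid_block (L : nat) (A : set (Rd R d)) : measurable A ->
  P (\bigcap_(j in `I_L) (X' j @^-1` A)) = (fine (muX' A) ^+ L)%:E.
Proof.
move=> mA; have -> : `I_L = [set` iota 0 L].
  by apply/seteqP; split => j /=; rewrite mem_iota.
rewrite (iid_bigcap (A := fun=> A) hX') ?iota_uniq//.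
rewrite -[X in iota 0 X]subn0 -/(index_iota 0 L) big_mkord.
elim: L => [|L IH]; first by rewrite big_ord0.
by rewrite big_ord_recr/= IH exprSr EFinM fineK// fin_num_measure.
Qed.

(** If A is null for muX', then B is null for muX. Otherwise the first L points all avoid A with
    probability (1 - muX'(A))^L, which tends to 0. *)
Lemma sample_avoids_ball_negligible (B A : set (Rd R d)) :
  measurable B -> measurable A ->
  (muX' A = 0 -> muX B = 0)%E ->
  P.-negligible [set w | B (X 0%N w) /\ forall j, ~ A (X' j w)].
Proof.
move=> mB mA AB.
have mXA (Y : nat -> {RV P >-> Rd R d}) j C : measurable C ->
    measurable (Y j @^-1` C).
  by move=> mC; rewrite -[X in measurable X]setTI; exact: measurable_funP.
have mcap D : measurable (\bigcap_(j in D) (X' j @^-1` (~` A))).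
  by apply: bigcap_measurableType => j _; apply: mXA; exact: measurableC.
have mE : measurable (X 0%N @^-1` B `&` \bigcap_j (X' j @^-1` (~` A))).
  by apply: measurableI => //; exact: mXA.
exists (X 0%N @^-1` B `&` \bigcap_j (X' j @^-1` (~` A))); split => //.
  apply/eqP; rewrite -measure_le0; have [A0|A0] := eqVneq (muX' A) 0%E.
    by rewrite -(AB A0) -(hX.2 0%N _ mB) le_measure ?inE//; exact: mXA.
  pose p := fine (muX' (~` A)).
  have p1 : `|p| < 1.
    have fA : muX' A \is a fin_num by exact: fin_num_measure.
    rewrite /p probability_setC// -(fineK fA) -EFinB/=.
    have A1 : fine (muX' A) <= 1 by rewrite -lee_fin fineK// probability_le1.
    have A2 : 0 < fine (muX' A).
      by rewrite -lte_fin fineK// lt0e A0 measure_ge0.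
    by rewrite ger0_norm ?subr_ge0// ltrBlDr ltrDl.
  have pL : (p ^+ L)%:E @[L --> \oo] --> (0%:E : \bar R).
    by apply: cvg_EFin; [exact: nearW|exact: cvg_expr].
  apply: (cvge_ge _ pL); apply: nearW => L.
  rewrite -iid_block; last exact: measurableC.
  by apply: le_measure; rewrite ?inE// => w [_ h] j _; exact: h.
by move=> w /= [Bw h]; split => // j _; exact: h.
Qed.

(** Failure of density falls in countably many events: a rational ball contains X_0 but the ball of
    twice its radius contains no X'_j. If the larger ball is null for muX', the smaller one misses
    supp(muX'), hence supp(muX), and is null for muX. *)
Lemma sample_dense_ae : supp N muX `<=` supp N muX' ->
  {ae P, forall w, forall e : R, 0 < e -> exists j, N (X 0%N w - X' j w) < e}.
Proof.
move=> ha; pose rad p : R := p.+1%:R^-1.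
have rad0 p : 0 < rad p by rewrite invr_gt0.
pose D := ratrow R d.
pose bad n p := [set w | cball N (D n) (rad p) (X 0%N w) /\
                         forall j, ~ cball N (D n) (rad p + rad p) (X' j w)].
have bad0 n p : P.-negligible (bad n p).
  apply: sample_avoids_ball_negligible; [exact: measurable_cball..|move=> A0].
  apply/negligibleP; first exact: measurable_cball.
  apply: negligibleS (supp_negligible hN muX) => x Bx /ha.
  apply: notin_supp (rad0 p) _; apply/eqP; rewrite -measure_le0 -A0.
  by rewrite le_measure ?inE//; [exact: measurable_cball..|exact: cball_subset].
apply: (@negligibleS _ _ _ P (\bigcup_n \bigcup_p bad n p)); last first.
  by apply: negligible_bigcup => n; exact: negligible_bigcup.
move=> w; rewrite /= -existsNE => -[e /not_implyP[e0 /forallNP far]].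
(* A third of e: X_0 is within one radius of the rational centre, X'_j within two. *)
have [p pe] : exists p, rad p < e / 3.
  by have [|p] := @ltr_add_invr R 0 (e / 3); rewrite ?divr_gt0// add0r; exists p.
have [n xn] := ratrow_dense hN (X 0%N w) (rad0 p).
exists n => //; exists p => //; split; first by rewrite /cball/= (is_norm_distC hN) ltW.
move=> j; rewrite /cball/= => Dj; apply: (far j).
apply: (le_lt_trans (is_norm_dist_triangle hN (D n) _ _)).
apply: (@lt_le_trans _ _ (rad p + (rad p + rad p))); first exact: ltr_leD.
by move: pe; lra.
Qed.

Lemma measurable_norm_sample (Y : nat -> {RV P >-> Rd R d}) j :
  measurable_fun setT (fun w => N (Y j w)).
Proof. exact: measurableT_comp (measurable_is_norm hN) (measurable_funP _). Qed.

Lemma least_norm_tail (L : nat) (t : R) : (0 < L)%N ->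
  P [set w | (t < least L (fun j => N (X' j w)))%R] =
  (fine (muX' [set y | (t < N y)%R]) ^+ L)%:E.
Proof.
move=> L0; rewrite -iid_block; last exact: measurable_gt (measurable_is_norm hN).
congr (P _); apply/seteqP; split => w /=.
  by move/(least_gtP _ _ L0) => h j; exact: h.
by move=> h; apply/(least_gtP _ _ L0) => j; exact: h.
Qed.

Lemma least_norm_powR_lty (m0 : nat) (q : R) : (0 < m0)%N -> 0 <= q ->
  (\int[P]_w (least m0 (fun j => N (X' j w)))%:E < +oo)%E ->
  exists2 L, (0 < L)%N &
    (\int[P]_w (least L (fun j => N (X' j w)) `^ q)%:E < +oo)%E.
Proof.
move=> m00 q0 fin; pose a := Num.bound q.
have least0 L w : 0 <= least L (fun j => N (X' j w)).
  by apply: least_ge0 => j; exact: is_norm_ge0.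
have mleast L := measurable_least L (measurable_norm_sample X').
have fin' : (\int[P]_w (least m0 (fun j => N (X' j w)))%:E)%E \is a fin_num.
  by rewrite ge0_fin_numE// integral_ge0// => w _; rewrite lee_fin.
pose C := fine (\int[P]_w (least m0 (fun j => N (X' j w)))%:E)%E.
(* With a + 1 groups of m0 points the tail is at most (C / t)^(a+1), the decay required for an
   exponent q <= a. *)
exists (m0 * a.+1)%N; first by rewrite muln_gt0 m00.
apply: (@integral_powR_tail_lty _ _ _ P _ (C ^+ a.+1) q a) => //.
  exact/ltW/archi_boundP.
move=> t t1; have t0 : 0 < t by exact: lt_le_trans t1.
have markov : fine (muX' [set y | (t < N y)%R]) ^+ m0 <= C / t.
  rewrite ler_pdivlMr// -lee_fin EFinM fineK// -least_norm_tail// muleC.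
  by apply: integral_ge_tail => //; exact: ltW.
rewrite least_norm_tail ?muln_gt0 ?m00// lee_fin exprM -expr_div_n.
rewrite lerXn2r ?nnegrE ?exprn_ge0 ?fine_ge0//.
by rewrite (le_trans _ markov) ?exprn_ge0 ?fine_ge0.
Qed.

Lemma measurable_dist_sample (q : R) (i s : nat) j :
  measurable_fun setT (fun w => N (X i w - X' (s + j)%N w) `^ q).
Proof.
apply/measurable_EFinP.
exact: (measurable_powR_norm_sub hN q (measurable_funP (X i))
  (measurable_funP (X' (s + j)%N))).
Qed.

Lemma measurable_least_dist (q : R) (i s L : nat) :
  measurable_fun setT (fun w => least L (fun j => N (X i w - X' (s + j)%N w) `^ q)).
Proof. exact: (measurable_least L (measurable_dist_sample q i s)). Qed.

Lemma least_dist_ge0 (q : R) (i s L : nat) w :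
  0 <= least L (fun j => N (X i w - X' (s + j)%N w) `^ q).
Proof. by apply: least_ge0 => j; exact: powR_ge0. Qed.

(** The integrand is one function of the spliced sequence, whose law depends on neither i nor s.
    Writing [0 + j] makes the right-hand side the instance i = s = 0. *)
Lemma integral_least_dist_block (q : R) (i s L : nat) :
  (\int[P]_w (least L (fun j => N (X i w - X' (s + j)%N w) `^ q))%:E =
   \int[P]_w (least L (fun j => N (X 0%N w - X' (0 + j)%N w) `^ q))%:E)%E.
Proof.
pose h (z : path_space (Rd R d)) : \bar R :=
  (least L (fun j => N (z 0%N - z j.+1) `^ q))%:E.
have mh : measurable_fun setT h.
  apply/measurable_EFinP; apply: measurable_least => j; apply/measurable_EFinP.
  exact: (measurable_powR_norm_sub hN q (measurable_coord 0) (measurable_coord j.+1)).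
have h0 z : (0 <= h z)%E.
  by rewrite lee_fin least_ge0// => j; exact: powR_ge0.
exact: (ge0_integral_same_fdd (splice_same_fdd i s 0 0 hX hX' hXX') mh h0).
Qed.

Lemma integral_least_dist_lty (m0 : nat) (q : R) : (0 < m0)%N -> 0 <= q ->
  (\int[P]_w (least m0 (fun j => N (X' j w)))%:E < +oo)%E ->
  (\int[muX]_x (N x `^ q)%:E < +oo)%E ->
  exists2 L, (0 < L)%N &
    (\int[P]_w (least L (fun j => N (X 0%N w - X' (0 + j)%N w) `^ q))%:E < +oo)%E.
Proof.
move=> m00 q0 fin finX.
have [L L0 finL] := least_norm_powR_lty m00 q0 fin; exists L => //.
have mX : measurable_fun setT (fun x : Rd R d => (N x `^ q)%:E).
  apply/measurable_EFinP.
  exact: (measurableT_comp (measurable_powR q) (measurable_is_norm hN)).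
have XE : (\int[P]_w (N (X 0%N w) `^ q)%:E = \int[muX]_x (N x `^ q)%:E)%E.
  rewrite -(@ge0_integral_distribution _ _ _ _ _ P (X 0%N) (fun x => (N x `^ q)%:E))//.
    by apply: eq_measure_integral => A mA _; exact: hX.2.
  by move=> y; rewrite lee_fin powR_ge0.
apply: (@le_lt_trans _ _ (\int[P]_w ((2 `^ q)%:E *
    ((N (X 0%N w) `^ q)%:E + (least L (fun j => N (X' j w)) `^ q)%:E)))%E).
  apply: ge0_le_integral_any => w; first by rewrite lee_fin least_dist_ge0.
  (* The index minimising the norm of X'_j serves as a competitor for the distance to X_0. *)
  have [j jL lj] := least_eq (fun j => N (X' j w)) L0.
  rewrite lj -EFinD -EFinM lee_fin (le_trans (least_le _ jL))//.
  apply: le_trans (powR_add_le q0 (is_norm_ge0 hN _) (is_norm_ge0 hN _)).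
  rewrite ge0_ler_powR ?nnegrE ?addr_ge0 ?is_norm_ge0//.
  by rewrite (le_trans (norm_triangle hN _ _))// (is_normN hN).
have mX0 : measurable_fun setT (fun w => (N (X 0%N w) `^ q)%:E).
  exact: (measurableT_comp mX (measurable_funP (X 0%N))).
have mL : measurable_fun setT (fun w => (least L (fun j => N (X' j w)) `^ q)%:E).
  apply/measurable_EFinP.
  exact: (measurableT_comp (measurable_powR q)
    (measurable_least L (measurable_norm_sample X'))).
rewrite ge0_integralZl_EFin ?powR_ge0//; last 2 first.
- by move=> w _; rewrite -EFinD lee_fin addr_ge0// powR_ge0.
- exact: emeasurable_funD.
rewrite ge0_integralD//; last 2 first.
- by move=> w _; rewrite lee_fin powR_ge0.
- by move=> w _; rewrite lee_fin powR_ge0.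
by rewrite lte_mul_pinfty ?lee_fin ?powR_ge0// lte_add_pinfty// XE.
Qed.

End nearest_point.

(** * The expected minimal distance tends to 0 *)

Section nearest_point_limit.
Context (R : realType) (d : nat) (N : 'rV[R]_d -> R) (hN : is_norm N)
  (dO : measure_display) (Omega : measurableType dO) (P : probability Omega R)
  (muX muX' : probability (Rd R d) R) (X X' : nat -> {RV P >-> Rd R d})
  (hX : iid P X muX) (hX' : iid P X' muX') (hXX' : independent_samples P X X').

Lemma least_dist_cvg (q : R) (L0 : nat) w : 0 < q -> (0 < L0)%N ->
  (forall e : R, 0 < e -> exists j, N (X 0%N w - X' j w) < e) ->
  (least (L0 + n) (fun j => N (X 0%N w - X' (0 + j)%N w) `^ q))%:E
    @[n --> \oo] --> (0%:E : \bar R).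
Proof.
move=> q0 L00 close; apply: cvg_EFin; first exact: nearW.
apply/cvgr0Pnorm_lt => e e0.
(* The q-th power of this radius is e; every minimum over more than j points is then below e. *)
have [|j je] := close (e `^ q^-1); first exact: powR_gt0.
exists j => // n /= jn.
rewrite ger0_norm; last by apply: least_ge0 => i; exact: powR_ge0.
apply: (@le_lt_trans _ _ (N (X 0%N w - X' j w) `^ q)).
  apply: (least_le (fun j => N (X 0%N w - X' (0 + j)%N w) `^ q)).
  by rewrite (leq_ltn_trans jn)// -[ltnLHS]add0n ltn_add2r.
rewrite -[ltRHS](powRr1 (ltW e0)) -(mulVf (lt0r_neq0 q0)) powRrM.
by rewrite gt0_ltr_powR ?nnegrE ?is_norm_ge0 ?powR_ge0.
Qed.

(** Dominated convergence along L0 + n: minima decrease with the number of points, so the integrable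
    one over L0 points dominates. The same monotonicity passes from one index to all larger L'. *)
Lemma integral_least_dist_small (m0 : nat) (q : R) :
  supp N muX `<=` supp N muX' -> (0 < m0)%N -> 0 < q ->
  (\int[P]_w (least m0 (fun j => N (X' j w)))%:E < +oo)%E ->
  (\int[muX]_x (N x `^ q)%:E < +oo)%E ->
  forall e : R, 0 < e -> exists2 L, (0 < L)%N & forall L', (L <= L')%N ->
  (\int[P]_w (least L' (fun j => N (X 0%N w - X' (0 + j)%N w) `^ q))%:E < e%:E)%E.
Proof.
move=> ha m00 q0 fin finX e e0.
have [L0 L00 finL0] := integral_least_dist_lty hN hX hX' m00 (ltW q0) fin finX.
pose f L w := (least L (fun j => N (X 0%N w - X' (0 + j)%N w) `^ q))%:E.
have mf L : measurable_fun setT (f L).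
  by apply/measurable_EFinP; exact: (measurable_least_dist hN X X' q 0 0 L).
have f0 L w : (0 <= f L w)%E by rewrite lee_fin; apply: least_ge0 => j; exact: powR_ge0.
have f_cvg : {ae P, forall w, setT w ->
    f (L0 + n)%N w @[n --> \oo] --> cst 0%E w}.
  apply: filterS (sample_dense_ae hN hX hX' ha) => w close _.
  exact: least_dist_cvg.
have f_int : P.-integrable setT (f L0).
  apply/integrableP; split => //.
  by under eq_integral do rewrite gee0_abs//.
have f_le : {ae P, forall w n, setT w -> (`|f (L0 + n)%N w| <= f L0 w)%E}.
  apply: filterE => w n _; rewrite gee0_abs// lee_fin.
  by rewrite le_least// leq_addr.
have [_ _] := dominated_convergence measurableT (fun n => mf (L0 + n)%N)
  (measurable_cst _) f_cvg f_int f_le.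
rewrite integral0 => /(_ [set x | (x < e%:E)%E])[|n _ fn].
  by apply: open_ereal_lt'; rewrite lte_fin.
exists (L0 + n)%N; first by rewrite addn_gt0 L00.
move=> L' nL'; apply: le_lt_trans (fn n (leqnn n)).
apply: ge0_le_integral_any => w; first exact: f0.
rewrite lee_fin le_least//.
by rewrite addn_gt0 L00.
Qed.

End nearest_point_limit.

(** * Assembling the block bound into a limit uniform in n *)

Theorem theorem3p3 (R : realType) (d : nat) (N : 'rV[R]_d -> R) (hN : is_norm N)
  (dO : measure_display) (Omega : measurableType dO) (P : probability Omega R)
  (muX muX' : probability (Rd R d) R)
  (X X' : nat -> {RV P >-> Rd R d})
  (hX : iid P X muX) (hX' : iid P X' muX')
  (hXX' : independent_samples P X X')
  (ha : supp N muX `<=` supp N muX')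
  (hb : exists m0 : nat, (1 <= m0)%N /\
    ('E_P[fun w => \big[Num.min/N (X' 0%N w)]_(j < m0) N (X' j w)] < +oo)%E) :
  forall q : R, 1 <= q -> (\int[muX]_x (N x `^ q)%:E < +oo)%E ->
  forall k : nat -> nat, (forall m, (1 <= m)%N -> (0 < k m <= m)%N) ->
  ((k m)%:R / m%:R : R) @[m --> \oo] --> (0 : R) ->
  forall e : R, 0 < e -> \forall m \near \oo, forall n, (1 <= n)%N ->
    (\int[P]_w (wasserstein N q (empirical n (X ^~ w))
                  (nn_empirical N n m (k m) (X ^~ w) (X' ^~ w)) `^ q)
     < e%:E)%E.
Proof.
move=> q q1 finX k km k_cvg e e0; have [m0 [m00 fin]] := hb.
rewrite unlock in fin.
have q0 : 0 < q by exact: lt_le_trans q1.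
have [L L0 small] := integral_least_dist_small hN hX hX' ha m00 q0 fin finX e0.
(* L depends on e alone, and m is taken large before n is introduced: this order is the uniformity
   in n. *)
near=> m => n n0.
have m1 : (1 <= m)%N by near: m; exact: nbhs_infty_ge.
have kmm := km m m1; have /andP[k0 _] := kmm.
have Lm : (k m * L <= m)%N.
  have : `|(k m)%:R / m%:R : R| < L%:R^-1.
    by near: m; apply: cvgr0_norm_lt => //; rewrite invr_gt0 ltr0n.
  rewrite ger0_norm// ltr_pdivrMr ?ltr0n// mulrC ltr_pdivlMr ?ltr0n//.
  by rewrite -natrM ltr_nat => /ltnW.
have c_fin : (\int[P]_w (least L (fun j => N (X 0%N w - X' (0 + j)%N w) `^ q))%:E)%E
    \is a fin_num.
  rewrite ge0_fin_numE; first by rewrite (lt_trans (small L (leqnn L)))// ltry.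
  by apply: integral_ge0 => w _; rewrite lee_fin; apply: least_ge0 => j; exact: powR_ge0.
apply: le_lt_trans (small L (leqnn L)).
rewrite -(fineK c_fin); set c := fine _.
(* The one-block expectation c is rewritten as the integral of the double average over points and
   blocks, so that the integrands can be compared pointwise. *)
rewrite -(@integral_average _ _ _ P n (fun i w => (k m)%:R^-1 * \sum_(b < k m)
  least L (fun j => N (X i w - X' (b * L + j)%N w) `^ q)) c n0).
- apply: ge0_le_integral_any => w; first exact: poweR_ge0.
  exact: wasserstein_neighbour_le.
- move=> i; apply: measurable_funM => //; apply: measurable_sum => b.
  exact: (measurable_least_dist hN X X' q i (b * L) L).
- move=> i w; rewrite mulr_ge0// sumr_ge0// => b _.
  by apply: least_ge0 => j; exact: powR_ge0.
move=> i.
apply: (@integral_average _ _ _ P (k m) (fun b w =>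
  least L (fun j => N (X i w - X' (b * L + j)%N w) `^ q))) => // b.
- exact: (measurable_least_dist hN X X' q i (b * L) L).
- by move=> w; apply: least_ge0 => j; exact: powR_ge0.
by rewrite (integral_least_dist_block hN hX hX' hXX') fineK.
Unshelve. all: by end_near. Qed.
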